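(* Let $\zeta$ be a state space of finite volume $V(\zeta)$, let $n_{\max}$ be the maximum cardinality, and let $\digamma$ be the family of multi-object (RFS) densities over $\zeta$. Then the following defines a multi-object uninformative density over $\digamma$: $$\pi_{ui}(X)=\begin{cases}\dfrac{1}{\sum_{m=0}^{n_{\max}}\frac{[V(\zeta)]^m}{m!}}, & \text{if } X\in\mathcal{F}(\zeta),\\[2mm] 0, & \text{otherwise},\end{cases}$$ and, if $n_{\max}\to+\infty$ (no bound on the cardinality), $$\pi_{ui}(X)=\begin{cases}e^{-V(\zeta)}, & \text{if } X\in\mathcal{F}(\zeta),\\ 0, & \text{otherwise}.\end{cases}$$ That is, in each case $\pi_{ui}$ is an RFS density satisfying $\pi\oplus\pi_{ui}=\pi$ for all $\pi\in\digamma$ and $\omega\odot\pi_{ui}=\pi_{ui}$ for all $\omega\in[0,1]$.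
   Context: $\mathcal{F}(\zeta)$ denotes the collection of finite subsets of $\zeta$ of cardinality at most $n_{\max}$ (all finite subsets when $n_{\max}=+\infty$). A multi-object (RFS) density over $\zeta$ is a function $\pi\ge 0$ on finite sets, supported on $\mathcal{F}(\zeta)$, with $\int\pi(X)\,\delta X=1$, where the set integral over $\mathcal F(\zeta)$ is $\int f(X)\,\delta X=\sum_{n=0}^{n_{\max}}\frac{1}{n!}\int_{\zeta^n}f(\{x_1,\dots,x_n\})\,dx_1\cdots dx_n$. Volume $V(\zeta)$ is Lebesgue measure. For densities $\pi,\pi'$ and $\omega\in[0,1]$ define $$\pi\oplus\pi'\triangleq\frac{\pi(X)\,\pi'(X)}{\int\pi(X)\,\pi'(X)\,\delta X},\qquad \omega\odot\pi\triangleq\frac{\pi(X)^\omega}{\int\pi(X)^\omega\,\delta X},$$ as densities on $\mathcal{F}(\zeta)$. Definition: given a family $\digamma$ of RFS densities over a state space, an RFS density $\pi_{ui}$ is (multi-object) uninformative if $\pi\oplus\pi_{ui}=\pi$ for all $\pi\in\digamma$, and $\omega\odot\pi_{ui}=\pi_{ui}$ for all $\omega\in[0,1]$. *)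

(* Defs.v *)
From HB Require Import structures.
From mathcomp Require Import all_boot all_order all_algebra finmap.
From mathcomp Require Import all_classical all_reals all_analysis.
Set Implicit Arguments.
Unset Strict Implicit.
Unset Printing Implicit Defensive.
Import Order.TTheory GRing.Theory Num.Theory.
Import numFieldNormedType.Exports.
Local Open Scope classical_set_scope.
Local Open Scope ring_scope.

Section cons_measure.
Local Open Scope ereal_scope.
Context d (T : measurableType d) (R : realType) (n : nat).
Variable mu : {sigma_finite_measure set T -> \bar R}.
Variable nu : {sigma_finite_measure set (n.-tuple T) -> \bar R}.

Definition pair_cons (p : T * n.-tuple T) : n.+1.-tuple T :=
  [tuple of p.1 :: p.2].

Lemma measurable_pair_cons : measurable_fun [set: T * n.-tuple T] pair_cons.
Proof. exact: measurable_cons. Qed.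

(* the product measure mu \x nu, transported to (n+1)-tuples *)
Definition cons_measure : set (n.+1.-tuple T) -> \bar R :=
  pushforward (mu \x nu) pair_cons.

Let cons_measure0 : cons_measure set0 = 0.
Proof. by rewrite /cons_measure /pushforward preimage_set0 measure0. Qed.

Let cons_measure_ge0 A : 0 <= cons_measure A.
Proof. exact: (measure_ge0 (mu \x nu)%E). Qed.

Let cons_measure_sigma_additive : semi_sigma_additive cons_measure.
Proof.
have mp := measurable_pair_cons.
move=> F mF tF mUF; rewrite /cons_measure /pushforward preimage_bigcup.
apply: measure_semi_sigma_additive.
- by move=> i; rewrite -[X in measurable X]setTI; exact: mp.
- apply/trivIsetP => /= i j _ _ ij; rewrite -preimage_setI.
  by move/trivIsetP : tF => /(_ _ _ _ _ ij) ->//; rewrite preimage_set0.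
- by rewrite -preimage_bigcup -[X in measurable X]setTI; exact: mp.
Qed.

HB.instance Definition _ := isMeasure.Build _ _ _ cons_measure
  cons_measure0 cons_measure_ge0 cons_measure_sigma_additive.

Let cons_measure_sigma_finite : sigma_finite setT cons_measure.
Proof.
have /sigma_finiteP[F [FT ndF Foo]] := sigma_finiteT mu.
have /sigma_finiteP[G [GT ndG Goo]] := sigma_finiteT nu.
pose g (t : n.+1.-tuple T) : T * n.-tuple T := (thead t, [tuple of behead t]).
have mg : measurable_fun setT g.
  by apply/measurable_fun_pair; [exact: measurable_tnth|exact: measurable_behead].
have gK p : g (pair_cons p) = p.
  by case: p => x t; congr pair; exact/val_inj.
exists (fun i => g @^-1` (F i `*` G i)).
  rewrite -preimage_bigcup -[LHS](preimage_setT g); congr (_ @^-1` _).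
  apply/esym; rewrite -subTset => -[x t] _.
  have [i _ Fix] : (\bigcup_i F i) x by rewrite -FT.
  have [j _ Gjt] : (\bigcup_j G j) t by rewrite -GT.
  exists (maxn i j) => //; split => /=.
  - by move: x Fix; exact/subsetPset/ndF/leq_maxl.
  - by move: t Gjt; exact/subsetPset/ndG/leq_maxr.
move=> i; have [mFi Fioo] := Foo i; have [mGi Gioo] := Goo i; split.
  by rewrite -[X in measurable X]setTI; apply: mg => //; exact: measurableX.
rewrite /cons_measure /pushforward -comp_preimage.
rewrite (_ : g \o pair_cons = id); last by apply/funext => p /=; rewrite gK.
rewrite preimage_id product_measure1E// lte_mul_pinfty//.
by rewrite ge0_fin_numE.
Qed.

HB.instance Definition _ := Measure_isSigmaFinite.Build _ _ _ cons_measure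
  cons_measure_sigma_finite.

End cons_measure.

(* the n-fold product measure mu^n on n-tuples; mu^0 is the unit mass at the
   empty tuple *)
Fixpoint power_measure d (T : measurableType d) (R : realType)
    (mu : {sigma_finite_measure set T -> \bar R}) (n : nat) :
    {sigma_finite_measure set (n.-tuple T) -> \bar R} :=
  match n with
  | 0%N => \d_([tuple] : 0.-tuple T)
  | m.+1 => cons_measure mu (power_measure mu m)
  end.

(* R^dim is modelled by dim-tuples of reals *)
Definition lebesgue_Rn (R : realType) (dim : nat) :
    {sigma_finite_measure set (dim.-tuple (measurableTypeR R)) -> \bar R} :=
  power_measure (@lebesgue_measure R) dim.

Section multi_object.
Context d (T : measurableType d) (R : realType).
Variable mu : {sigma_finite_measure set T -> \bar R}.
Variable zeta : set T.
(* the maximum cardinality; None stands for +oo *)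
Variable nmax : option nat.
Implicit Types (f pi : {fset T} -> R) (X : {fset T}).

Definition card_ok (n : nat) : bool :=
  if nmax is Some N then (n <= N)%N else true.

Definition fin_subsets : set {fset T} :=
  [set X | [set` X] `<=` zeta /\ card_ok #|` X|].

Definition cart_power (n : nat) : set (n.-tuple T) :=
  [set t | forall i, zeta (tnth t i)].
Arguments cart_power n : clear implicits.

(* {x_1, ..., x_n}; it has fewer than n elements when the x_i are not
   pairwise distinct *)
Definition fset_of_tuple n (t : n.-tuple T) : {fset T} :=
  [fset x in (t : seq T)]%fset.

Definition set_integral_term f (n : nat) : \bar R :=
  ((n`!%:R^-1)%:E *
    \int[power_measure mu n]_(t in cart_power n) (f (fset_of_tuple t))%:E)%E.

Definition set_integral f : \bar R :=
  match nmax with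
  | Some N => (\sum_(0 <= n < N.+1) set_integral_term f n)%E
  | None => (\sum_(0 <= n <oo) set_integral_term f n)%E
  end.

(* measurability is what makes the integrals over zeta^n meaningful *)
Definition RFS_density pi : Prop :=
  [/\ forall X, 0 <= pi X,
      forall X, ~ fin_subsets X -> pi X = 0,
      forall n, card_ok n ->
        measurable_fun (cart_power n) (fun t => pi (fset_of_tuple t)) &
      set_integral pi = 1%:E].

(* junk value 0 if the set integral of f is 0 or +oo *)
Definition normalize f : {fset T} -> R :=
  fun X => if X \in fin_subsets then f X / fine (set_integral f) else 0.

Definition oplus pi pi' : {fset T} -> R :=
  normalize (fun X => pi X * pi' X).

(* note that 0 `^ 0 = 1 *)
Definition odot (w : R) pi : {fset T} -> R :=
  normalize (fun X => pi X `^ w).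

Definition uninformative (Fam : set ({fset T} -> R)) (pi_ui : {fset T} -> R)
    : Prop :=
  [/\ RFS_density pi_ui,
      forall pi, Fam pi -> oplus pi pi_ui = pi &
      forall w : R, 0 <= w <= 1 -> odot w pi_ui = pi_ui].

End multi_object.

(* Main.v *)
(** A function that is constant on [F(zeta)] acts as a scalar: for such a
    function both [oplus] and [odot] multiply the integrand by a positive
    constant, which the normalization cancels.  It remains to compute the set
    integral of [1] on [F(zeta)]: its [n]-th term is [V ^ n / n!], and these
    terms sum to the truncated exponential series, resp. to [exp V]. *)
Require Import Defs.
From mathcomp Require Import all_boot all_order all_algebra finmap.
From mathcomp Require Import all_classical all_reals all_analysis.
Import Order.TTheory GRing.Theory Num.Theory.
Import numFieldNormedType.Exports.
Local Open Scope classical_set_scope.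
Local Open Scope ring_scope.

Section constant_density.
Context d (T : measurableType d) (R : realType).
Variables (mu : {sigma_finite_measure set T -> \bar R}) (zeta : set T).
Hypothesis mzeta : measurable zeta.

Lemma measurable_cart_power n : measurable (cart_power zeta (n:=n)).
Proof.
rewrite (_ : cart_power zeta (n:=n) =
    \bigcap_(i in [set: 'I_n]) (fun t : n.-tuple T => tnth t i) @^-1` zeta).
  apply: fin_bigcap_measurable => // i _; rewrite -[X in measurable X]setTI.
  exact: measurable_tnth.
by apply/seteqP; split => t /= zt i => [_|]; apply: zt.
Qed.

Lemma preimage_pair_cons_cart_power n :
  @pair_cons d T n @^-1` cart_power zeta (n:=n.+1) =
  zeta `*` cart_power zeta (n:=n).
Proof.
apply/seteqP; split => -[x t] /=.
- move=> xt; split => /= [|i]; first exact: (xt ord0).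
  by have := xt (lift ord0 i); rewrite tnthS.
- move=> [/= zx zt] i; case: (unliftP ord0 i) => [j ->|->//].
  by rewrite tnthS.
Qed.

(** By induction: [pair_cons] pulls the power of [zeta] back to a rectangle, on which the product
    measure is multiplicative. For [n = 0] the empty tuple satisfies the condition vacuously, so the
    unit mass gives 1 even for empty [zeta]. *)
Lemma power_measure_cart_power n :
  power_measure mu n (cart_power zeta (n:=n)) = (mu zeta ^+ n)%E.
Proof.
elim: n => [|n IH].
  by rewrite /= diracE mem_set// => -[].
rewrite expeS -IH /= /cons_measure /pushforward preimage_pair_cons_cart_power.
by rewrite product_measure1E//; exact: measurable_cart_power.
Qed.

Section cardinality_bound.
Variable nmax : option nat.

(** Repeated entries can only lower the cardinality, and [card_ok] is closed downwards. *)
Lemma fset_of_tuple_fin_subsets n (t : n.-tuple T) :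
  card_ok nmax n -> cart_power zeta t -> fin_subsets zeta nmax (fset_of_tuple t).
Proof.
move=> okn zt; split => [x /=|].
  by rewrite inE => /tnthP[i ->]; exact: zt.
have : (#|` fset_of_tuple t| <= n)%N.
  by rewrite card_fseq (leq_trans (size_undup _))// size_tuple.
by move: okn; rewrite /card_ok; case: nmax => // N nN /leq_trans; exact.
Qed.

(** The set integral only evaluates [f] at sets in [fin_subsets], so agreement there is enough.
    Nonnegativity lets [a] leave the integrals and the sum even when their values are infinite. *)
Lemma set_integral_scale (f g : {fset T} -> R) (a : R) : 0 <= a ->
  (forall X, 0 <= g X) ->
  (forall n, card_ok nmax n ->
    measurable_fun (cart_power zeta (n:=n)) (fun t => g (fset_of_tuple t))) ->
  (forall X, fin_subsets zeta nmax X -> f X = a * g X) ->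
  set_integral mu zeta nmax f = (a%:E * set_integral mu zeta nmax g)%E.
Proof.
move=> a0 g0 mg fg.
have term_ge0 n : (0 <= set_integral_term mu zeta g n)%E.
  rewrite mule_ge0 ?lee_fin ?invr_ge0// integral_ge0// => t _.
  by rewrite lee_fin.
have termE n : card_ok nmax n ->
    set_integral_term mu zeta f n = (a%:E * set_integral_term mu zeta g n)%E.
  move=> okn; rewrite /set_integral_term muleCA; congr (_ * _)%E.
  rewrite -ge0_integralZl ?lee_fin//.
  - apply: eq_integral => t /[!inE] zt.
    by rewrite fg ?EFinM//; exact: fset_of_tuple_fin_subsets.
  - exact: measurable_cart_power.
  - by apply/measurable_realfun.measurable_EFinP; exact: mg.
  - by move=> t _; rewrite lee_fin.
rewrite /set_integral; case: nmax termE => [N|] termE.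
  rewrite ge0_sume_distrr//; apply: eq_big_nat => n /andP[_ nN].
  exact: termE.
by rewrite -nneseriesZl//; apply: eq_eseriesr => n _; exact: termE.
Qed.

Lemma constant_uninformative (c : R) : 0 < c ->
  set_integral mu zeta nmax (cst 1) = c^-1%:E ->
  uninformative mu zeta nmax [set pi | RFS_density mu zeta nmax pi]
    (fun X => if X \in fin_subsets zeta nmax then c else 0).
Proof.
move=> c0 int1; set u := fun X => if _ then _ else _.
have uE X : fin_subsets zeta nmax X -> u X = c.
  by move=> FX; rewrite /u mem_set.
have uN X : ~ fin_subsets zeta nmax X -> u X = 0.
  by move=> FX; rewrite /u memNset.
have int_cst f (a : R) : 0 <= a ->
    (forall X, fin_subsets zeta nmax X -> f X = a) ->
    set_integral mu zeta nmax f = (a / c)%:E.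
  move=> a0 fa; rewrite (@set_integral_scale f (cst 1) a)//=.
  - by rewrite int1 -EFinM.
  - by move=> X FX; rewrite fa// mulr1.
split.
- split=> // [X|n okn|].
  + by rewrite /u; case: ifP => // _; exact: ltW.
  + apply: (eq_measurable_fun (cst c)) => // t /[!inE] zt.
    by rewrite uE//; exact: fset_of_tuple_fin_subsets.
  + by rewrite (int_cst u c)// ?divff ?gt_eqF// ltW.
- move=> pi [pi0 piN mpi intpi]; apply/funext => X; rewrite /oplus /normalize.
  (* The normalizing constant is [c], since [pi] has set integral 1. *)
  rewrite (@set_integral_scale _ pi c) ?intpi ?mule1 ?(ltW c0)//; last first.
    by move=> Y FY; rewrite uE// mulrC.
  case: ifPn => [/set_mem FX|/negP FX].
    by rewrite uE//= mulfK// gt_eqF.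
  by rewrite piN// => FX'; apply: FX; exact: mem_set.
- move=> w _; apply/funext => X; rewrite /odot /normalize.
  (* For [w = 0] the integrand is 1 outside [fin_subsets], but the set integral does not see this
     and [normalize] resets the value to 0. Inside, dividing [c]^ w[by]c [^ w / c] returns [c]. *)
  rewrite (int_cst _ (c `^ w)) ?powR_ge0//; last first.
    by move=> Y FY; rewrite uE.
  rewrite {2}/u; case: ifPn => // /set_mem FX.
  have cw0 : c `^ w != 0 by rewrite gt_eqF// powR_gt0.
  by rewrite uE//= invf_div mulrCA divff// mulr1.
Qed.

End cardinality_bound.

Section finite_volume.
Hypothesis zeta_fin : (mu zeta < +oo)%E.
Let V := fine (mu zeta).

Lemma set_integral_term_cst1 n :
  set_integral_term mu zeta (cst 1) n = (V ^+ n / n`!%:R)%:E.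
Proof.
rewrite /set_integral_term.
rewrite [X in (_ * X)%E](_ : _ = (mu zeta ^+ n)%E); last first.
  rewrite -power_measure_cart_power -[RHS]mul1e.
  exact: integral_cst (measurable_cart_power n) 1%E.
rewrite -(@fineK _ (mu zeta)) ?ge0_fin_numE//.
by rewrite -EFin_expe -EFinM mulrC.
Qed.

Lemma set_integral_cst1_bounded N :
  set_integral mu zeta (Some N) (cst 1) =
  (\sum_(0 <= n < N.+1) V ^+ n / n`!%:R)%:E.
Proof.
rewrite /set_integral -sumEFin; apply: eq_bigr => n _.
exact: set_integral_term_cst1.
Qed.

(** The terms are the coefficients of the series whose limit defines [expR]; its convergence allows
    [EFin] to commute with the limit. *)
Lemma set_integral_cst1_unbounded :
  set_integral mu zeta None (cst 1) = (expR V)%:E.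
Proof.
rewrite /set_integral (eq_eseriesr (fun n _ => set_integral_term_cst1 n)).
rewrite /expR -EFin_lim; last exact: is_cvg_series_exp_coeff.
by congr (limn _); apply/funext => n; rewrite /= sumEFin.
Qed.

End finite_volume.

End constant_density.

Theorem proposition4 (R : realType) (dim : nat)
    (zeta : set (dim.-tuple (measurableTypeR R)))
    (mzeta : measurable zeta)
    (zeta_fin : (lebesgue_Rn R dim zeta < +oo)%E) :
  let V : R := fine (lebesgue_Rn R dim zeta) in
  (forall N : nat,
     uninformative (lebesgue_Rn R dim) zeta (Some N)
       [set pi | RFS_density (lebesgue_Rn R dim) zeta (Some N) pi]
       (fun X => if X \in fin_subsets zeta (Some N)
                 then 1 / (\sum_(0 <= m < N.+1) V ^+ m / m`!%:R)
                 else 0))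
  /\
  uninformative (lebesgue_Rn R dim) zeta None
    [set pi | RFS_density (lebesgue_Rn R dim) zeta None pi]
    (fun X => if X \in fin_subsets zeta None then expR (- V) else 0).
Proof.
move=> V; split => [N|].
  apply: constant_uninformative => //.
  - have V0 : 0 <= V by exact: fine_ge0.
    (* The term [m = 0] equals 1 and the others are nonnegative, so the sum is positive even when
       [V = 0]. *)
    rewrite mul1r invr_gt0 big_nat_recl//= expr0 fact0 divr1.
    by rewrite ltr_pwDl// sumr_ge0// => m _; rewrite divr_ge0// exprn_ge0.
  - by rewrite mul1r invrK set_integral_cst1_bounded.
apply: constant_uninformative => //; first exact: expR_gt0.
by rewrite expRN invrK set_integral_cst1_unbounded.
Qed.
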